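(* Let $(A,\vartriangleright,\vartriangleleft)$ be an anti-dendriform algebra. Then: (1) With the operation $x\cdot y=x\vartriangleright y+x\vartriangleleft y$ ($x,y\in A$), $(A,\cdot)$ is an associative algebra. (2) With the operation $x\circ y=x\vartriangleright y-y\vartriangleleft x$ ($x,y\in A$), $(A,\circ)$ is an anti-pre-Lie algebra. (3) $(A,\cdot)$ and $(A,\circ)$ have the same sub-adjacent Lie algebra, whose bracket is $$[x,y]=x\vartriangleright y+x\vartriangleleft y-y\vartriangleright x-y\vartriangleleft x,\qquad \forall x,y\in A.$$
   Context: All vector spaces are finite-dimensional over a field $\mathbb F$ of characteristic $0$. Anti-dendriform algebra: a vector space $A$ with two bilinear operations $\vartriangleright,\vartriangleleft$ such that, with $x\cdot y=x\vartriangleright y+x\vartriangleleft y$, for all $x,y,z\in A$, $$x\vartriangleright(y\vartriangleright z)=-(x\cdot y)\vartriangleright z=-x\vartriangleleft(y\cdot z)=(x\vartriangleleft y)\vartriangleleft z,\qquad (x\vartriangleright y)\vartriangleleft z=x\vartriangleright(y\vartriangleleft z).$$ A vector space $A$ with a bilinear operation $\circ$ is Lie-admissible if the commutator $[x,y]=x\circ y-y\circ x$ is a Lie bracket on $A$; the resulting Lie algebra is the sub-adjacent Lie algebra of $(A,\circ)$. (Associative algebras are Lie-admissible.) Anti-pre-Lie algebra: a vector space $A$ with a bilinear operation $\circ$ such that, with $[x,y]=x\circ y-y\circ x$, for all $x,y,z\in A$, $$x\circ(y\circ z)-y\circ(x\circ z)=[y,x]\circ z,\qquad [x,y]\circ z+[y,z]\circ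 x+[z,x]\circ y=0.$$ Equivalently, it is a Lie-admissible algebra satisfying the first of these identities. *)

(* Defs.v *)
From mathcomp Require Import all_boot all_order all_algebra.

Set Implicit Arguments.
Unset Strict Implicit.
Unset Printing Implicit Defensive.

Import GRing.Theory.
Local Open Scope ring_scope.

Section Algebras.
Variables (F : fieldType) (A : vectType F).
Implicit Types op rt lt br : A -> A -> A.

Definition bilinear_op op : Prop :=
  bilinear_for *:%R *:%R op.

Definition commutator op (x y : A) : A := op x y - op y x.

Record is_assoc_algebra op : Prop := IsAssocAlgebra {
  assoc_bilinear : bilinear_op op;
  assoc_associative : associative op
}.

Record is_lie_bracket br : Prop := IsLieBracket {
  lie_bilinear : bilinear_op br;
  lie_alternating : forall x, br x x = 0;
  lie_jacobi : forall x y z,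
    br x (br y z) + br y (br z x) + br z (br x y) = 0
}.

Record is_lie_admissible op : Prop := IsLieAdmissible {
  lie_admissible_bilinear : bilinear_op op;
  lie_admissible_commutator : is_lie_bracket (commutator op)
}.

Record is_anti_pre_lie op : Prop := IsAntiPreLie {
  anti_pre_lie_bilinear : bilinear_op op;
  anti_pre_lie_left : forall x y z,
    op x (op y z) - op y (op x z) = op (commutator op y x) z;
  anti_pre_lie_cyclic : forall x y z,
    op (commutator op x y) z + op (commutator op y z) x
      + op (commutator op z x) y = 0
}.

(* [rt x y] is x ▷ y and [lt x y] is x ◁ y. *)
Definition dend_dot rt lt (x y : A) : A := rt x y + lt x y.

(* The arguments of the second operation are swapped: x ▷ y - y ◁ x. *)
Definition dend_circ rt lt (x y : A) : A := rt x y - lt y x.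

Record is_anti_dendriform rt lt : Prop := IsAntiDendriform {
  anti_dendriform_bilinear_rt : bilinear_op rt;
  anti_dendriform_bilinear_lt : bilinear_op lt;
  anti_dendriform_rt_rt : forall x y z,
    rt x (rt y z) = - rt (dend_dot rt lt x y) z;
  anti_dendriform_dot : forall x y z,
    - rt (dend_dot rt lt x y) z = - lt x (dend_dot rt lt y z);
  anti_dendriform_lt_lt : forall x y z,
    - lt x (dend_dot rt lt y z) = lt (lt x y) z;
  anti_dendriform_rt_lt : forall x y z,
    lt (rt x y) z = rt x (lt y z)
}.

(* The sub-adjacent Lie algebra of a Lie-admissible (A, op) has underlying
   space A and bracket [commutator op], so for two operations on A these Lie
   algebras coincide exactly when the brackets agree pointwise. *)
Definition same_sub_adjacent op1 op2 : Prop :=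
  [/\ is_lie_admissible op1, is_lie_admissible op2
    & commutator op1 =2 commutator op2].

End Algebras.

(* Main.v *)
Require Import Defs.
From mathcomp Require Import all_boot all_order all_algebra.
From mathcomp Require Import ring.

(** Write [T x y z] for the common value
      x ▷ (y ▷ z) = - (x · y) ▷ z = - x ◁ (y · z) = (x ◁ y) ◁ z,
    and [M x y z] for (x ▷ y) ◁ z = x ▷ (y ◁ z).  Every product of three
    elements that occurs below is one of [T], [-T], [M] at some permutation of
    its arguments, so each identity reduces to counting signed monomials.

    Associativity: both bracketings of x · y · z contain [T] twice with
    opposite signs, and what remains on each side is [M x y z].

    Sub-adjacent Lie algebra: the term - y ◁ x of the commutator comes from
    - y · x in one case and from x ∘ y in the other, and likewise for x ◁ y, so
    the two commutators agree.  The Jacobi identity is thus needed only for ·,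
    where it follows from associativity.

    Anti-pre-Lie identities: because the commutator of ∘ is that of ·, the
    product [x, y] ∘ z involves only (x · y) ▷ z and z ◁ (x · y), hence equals
      T y x z - T x y z + T z x y - T z y x      ([dend_circ_commutatorl]).
    In x ∘ (y ∘ z) - y ∘ (x ∘ z) the [M] terms are symmetric in x and y and
    cancel, leaving the same four values of [T] up to sign.  In the cyclic sum
    of [x, y] ∘ z each of the six permutations occurs once with each sign. *)

Set Implicit Arguments.
Unset Strict Implicit.
Unset Printing Implicit Defensive.

Import GRing.Theory.
Local Open Scope ring_scope.

(** Linear combinations in [A] are compared coordinatewise, where commutative
    ring normalization applies. *)
Lemma eq_coordinates (F : fieldType) (A : vectType F) (u v : A) :
  (forall i, coord (vbasis {:A}) i u = coord (vbasis {:A}) i v) -> u = v.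
Proof.
move=> eq_uv; rewrite (coord_vbasis (memvf u)) (coord_vbasis (memvf v)).
by apply: eq_bigr => i _; rewrite eq_uv.
Qed.

Ltac linear_combination :=
  apply: eq_coordinates => i;
  rewrite !(linearD, linearN, linearZ) /=; ring.

Section BilinearOperations.
Variables (F : fieldType) (A : vectType F) (op : A -> A -> A).
Hypothesis op_bilinear : bilinear_op op.

Lemma bilinear_opPl a x y z : op (a *: x + y) z = a *: op x z + op y z.
Proof. by case: op_bilinear => opl _; apply: opl. Qed.

Lemma bilinear_opPr a x y z : op z (a *: x + y) = a *: op z x + op z y.
Proof. by case: op_bilinear => _ opr; apply: opr. Qed.

Lemma bilinear_opBl x y z : op (x - y) z = op x z - op y z.
Proof. by rewrite addrC -scaleN1r bilinear_opPl scaleN1r addrC. Qed.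

Lemma bilinear_opBr x y z : op z (x - y) = op z x - op z y.
Proof. by rewrite addrC -scaleN1r bilinear_opPr scaleN1r addrC. Qed.

Lemma bilinear_opDl x y z : op (x + y) z = op x z + op y z.
Proof. by have := bilinear_opPl 1 x y z; rewrite !scale1r. Qed.

Lemma bilinear_opDr x y z : op z (x + y) = op z x + op z y.
Proof. by have := bilinear_opPr 1 x y z; rewrite !scale1r. Qed.

Lemma commutator_bilinear : bilinear_op (commutator op).
Proof.
by split=> u a x y; rewrite /commutator bilinear_opPl bilinear_opPr;
  linear_combination.
Qed.

End BilinearOperations.

Section LieAdmissibility.
Variables (F : fieldType) (A : vectType F).

Lemma assoc_lie_admissible (op : A -> A -> A) :
  is_assoc_algebra op -> is_lie_admissible op.
Proof.
case=> op_bilinear opA; split=> //; split=> [||x y z].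
- exact: commutator_bilinear.
- by move=> x; rewrite /commutator subrr.
rewrite /commutator !(bilinear_opBl op_bilinear) !(bilinear_opBr op_bilinear).
by rewrite !opA; linear_combination.
Qed.

Lemma eq_commutator_lie_admissible (op1 op2 : A -> A -> A) :
    bilinear_op op2 -> commutator op1 =2 commutator op2 ->
  is_lie_admissible op1 -> is_lie_admissible op2.
Proof.
move=> op2_bilinear eq_br [_ [_ br_alt br_jacobi]]; split=> //; split.
- exact: commutator_bilinear.
- by move=> x; rewrite -eq_br.
by move=> x y z; rewrite -!eq_br.
Qed.

End LieAdmissibility.

Section AntiDendriform.
Variables (F : fieldType) (A : vectType F) (rt lt : A -> A -> A).

Lemma commutator_dend_dot_circ :
  commutator (dend_dot rt lt) =2 commutator (dend_circ rt lt).
Proof.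
by move=> x y; rewrite /commutator /dend_dot /dend_circ; linear_combination.
Qed.

Hypothesis hA : is_anti_dendriform rt lt.

Let rt_bilinear := anti_dendriform_bilinear_rt hA.
Let lt_bilinear := anti_dendriform_bilinear_lt hA.

Lemma dend_dot_bilinear : bilinear_op (dend_dot rt lt).
Proof.
by split=> u a x y; rewrite /dend_dot ?(bilinear_opPl rt_bilinear)
  ?(bilinear_opPl lt_bilinear) ?(bilinear_opPr rt_bilinear)
  ?(bilinear_opPr lt_bilinear); linear_combination.
Qed.

Lemma dend_circ_bilinear : bilinear_op (dend_circ rt lt).
Proof.
by split=> u a x y; rewrite /dend_circ ?(bilinear_opPl rt_bilinear)
  ?(bilinear_opPl lt_bilinear) ?(bilinear_opPr rt_bilinear)
  ?(bilinear_opPr lt_bilinear); linear_combination.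
Qed.

(** The next three lemmas take x ▷ (y ▷ z) as the normal form [T x y z]. *)
Lemma rt_dot x y z : rt (dend_dot rt lt x y) z = - rt x (rt y z).
Proof. by rewrite (anti_dendriform_rt_rt hA) opprK. Qed.

Lemma lt_dot x y z : lt x (dend_dot rt lt y z) = - rt x (rt y z).
Proof.
by rewrite (anti_dendriform_rt_rt hA) (anti_dendriform_dot hA) opprK.
Qed.

Lemma lt_lt x y z : lt (lt x y) z = rt x (rt y z).
Proof. by rewrite -(anti_dendriform_lt_lt hA) lt_dot opprK. Qed.

Lemma dend_dotA : associative (dend_dot rt lt).
Proof.
have dotE u v : dend_dot rt lt u v = rt u v + lt u v by [].
move=> x y z; rewrite dotE [RHS]dotE lt_dot rt_dot !dotE.
rewrite (bilinear_opDr rt_bilinear) (bilinear_opDl lt_bilinear) lt_lt.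
by rewrite (anti_dendriform_rt_lt hA); linear_combination.
Qed.

(** Left multiplication by a commutator of ∘ only sees products by x · y
    and y · x, because the commutators of ∘ and · coincide; hence no mixed
    product (x ▷ y) ◁ z survives. *)
Lemma dend_circ_commutatorl x y z :
  dend_circ rt lt (commutator (dend_circ rt lt) x y) z =
    rt y (rt x z) - rt x (rt y z) + rt z (rt x y) - rt z (rt y x).
Proof.
rewrite -commutator_dend_dot_circ /commutator {1}/dend_circ.
rewrite (bilinear_opBl rt_bilinear) (bilinear_opBr lt_bilinear).
by rewrite !rt_dot !lt_dot; linear_combination.
Qed.

Lemma dend_circ_circ x y z :
  dend_circ rt lt x (dend_circ rt lt y z) =
    rt x (rt y z) + rt z (rt y x) - (rt x (lt z y) + rt y (lt z x)).
Proof.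
rewrite /dend_circ (bilinear_opBr rt_bilinear) (bilinear_opBl lt_bilinear).
by rewrite lt_lt (anti_dendriform_rt_lt hA); linear_combination.
Qed.

Lemma dend_dot_assoc_algebra : is_assoc_algebra (dend_dot rt lt).
Proof. by split; [exact: dend_dot_bilinear | exact: dend_dotA]. Qed.

Lemma dend_circ_anti_pre_lie : is_anti_pre_lie (dend_circ rt lt).
Proof.
split=> [|x y z|x y z]; first exact: dend_circ_bilinear.
  by rewrite dend_circ_commutatorl !dend_circ_circ; linear_combination.
by rewrite !dend_circ_commutatorl; linear_combination.
Qed.

Lemma dend_same_sub_adjacent :
  same_sub_adjacent (dend_dot rt lt) (dend_circ rt lt).
Proof.
have dot_lie := assoc_lie_admissible dend_dot_assoc_algebra.
split=> //; last exact: commutator_dend_dot_circ.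
apply: eq_commutator_lie_admissible dot_lie.
  exact: dend_circ_bilinear.
exact: commutator_dend_dot_circ.
Qed.

End AntiDendriform.

Theorem proposition2p5 (F : fieldType) (A : vectType F) (rt lt : A -> A -> A)
    (charF0 : [pchar F] =i pred0) (hA : is_anti_dendriform rt lt) :
  is_assoc_algebra (dend_dot rt lt)
  /\ is_anti_pre_lie (dend_circ rt lt)
  /\ same_sub_adjacent (dend_dot rt lt) (dend_circ rt lt)
  /\ (forall x y : A,
        commutator (dend_dot rt lt) x y = rt x y + lt x y - rt y x - lt y x).
Proof.
split; first exact: dend_dot_assoc_algebra.
split; first exact: dend_circ_anti_pre_lie.
split; first exact: dend_same_sub_adjacent.
by move=> x y; rewrite /commutator /dend_dot opprD addrA.
Qed.
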